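(* Let $\mathcal{A}=(Q,\Sigma,\delta,q_0,F)$ be a deterministic finite automaton and let $L=L(\mathcal{A})$ be the language it recognizes. Define the DFA $\mathcal{A}'=(Q^Q,\Sigma,\delta',q_0',F')$, where $q_0'=\delta_\epsilon$ is the identity transformation of $Q$, $F'=\{f\in Q^Q : \exists n\ge 1 \text{ such that } f^n(q_0)\in F\}$, and $\delta'(f,a)=f\delta_a$ for all $f\in Q^Q$ and $a\in\Sigma$. Then $\mathrm{root}(L)=L(\mathcal{A}')$.
   Context: A DFA is a 5-tuple $(Q,\Sigma,\delta,q_0,F)$ with $Q$ a finite non-empty set of states, $\Sigma$ a finite alphabet, $\delta:Q\times\Sigma\to Q$ a total transition function (extended to $Q\times\Sigma^*$ in the usual way), $q_0\in Q$ the initial state and $F\subseteq Q$ the set of final states; $L(\mathcal{A})=\{w\in\Sigma^*:\delta(q_0,w)\in F\}$. $Q^Q$ is the set of all functions $Q\to Q$ (transformations); composition is written left to right: $(fg)(q)=g(f(q))$. For $w\in\Sigma^*$, $\delta_w\in Q^Q$ is given by $\delta_w(q)=\delta(q,w)$; $\epsilon$ is the empty word. For a language $L\subseteq\Sigma^*$, $\mathrm{root}(L)=\{w\in\Sigma^* : \exists n\ge 1 \text{ such that } w^n\in L\}$. *)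

(* Defs.v *)
From mathcomp Require Import all_boot.
From mathcomp Require Import boolp classical_sets.

Set Implicit Arguments.
Unset Strict Implicit.
Unset Printing Implicit Defensive.

(* Nonemptiness of Q is witnessed by the initial state. *)
Record dfa (Sigma Q : finType) := DFA {
  dfa_delta : Q -> Sigma -> Q;
  dfa_init : Q;
  dfa_final : {set Q}
}.

Definition language (Sigma : finType) := set (seq Sigma).

Definition delta_ext (Sigma Q : finType) (A : dfa Sigma Q)
  (q : Q) (w : seq Sigma) : Q := foldl (dfa_delta A) q w.

Definition dfa_lang (Sigma Q : finType) (A : dfa Sigma Q) : language Sigma :=
  [set w | delta_ext A (dfa_init A) w \in dfa_final A]%classic.

Definition word_exp (Sigma : finType) (w : seq Sigma) (n : nat) : seq Sigma :=
  flatten (nseq n w).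

Definition lang_root (Sigma : finType) (L : language Sigma) : language Sigma :=
  [set w | exists n : nat, 1 <= n /\ L (word_exp w n)]%classic.

Notation transformation Q := {ffun Q -> Q}.

Definition tr_id (Q : finType) : transformation Q := [ffun q => q].

(* Composition is written from left to right: f acts first. *)
Definition tr_mul (Q : finType) (f g : transformation Q) : transformation Q :=
  [ffun q => g (f q)].

Definition tr_exp (Q : finType) (f : transformation Q) (n : nat) :
  transformation Q := iter n (tr_mul f) (tr_id Q).

Definition delta_word (Sigma Q : finType) (A : dfa Sigma Q) (w : seq Sigma) :
  transformation Q := [ffun q => delta_ext A q w].

(* The exponent n is unbounded, so membership in the final set is turned into
   a boolean by the classical `[< _ >]. *)
Definition root_dfa (Sigma Q : finType) (A : dfa Sigma Q) :
  dfa Sigma (transformation Q) :=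
  {| dfa_delta := fun f a => tr_mul f (delta_word A [:: a]);
     dfa_init := delta_word A [::];
     dfa_final := [set f : transformation Q |
       `[< exists n : nat, 1 <= n /\ tr_exp f n (dfa_init A) \in dfa_final A >]]
  |}.

(* Main.v *)
Require Import Defs.
From mathcomp Require Import all_boot.
From mathcomp Require Import boolp classical_sets.

(** After reading [w], the root automaton is in state [delta_word A w] ([delta_ext_root_dfa_init]).
    Concatenation of words becomes composition of transformations, so [w^n] acts as the [n]-th power
    of that state ([delta_ext_word_exp]). Acceptance of [w] thus means [w^n] is in the language,
    with the same [n] on both sides. *)

(** The start [f] is arbitrary because each letter read changes it in the induction. *)
Lemma delta_ext_root_dfa (Sigma Q : finType) (A : dfa Sigma Q)
    (f : transformation Q) (w : seq Sigma) :
  delta_ext (root_dfa A) f w = tr_mul f (delta_word A w).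
Proof.
elim: w f => [|a w IHw] f; first by apply/ffunP => q; rewrite !ffunE.
rewrite [LHS]IHw.
by apply/ffunP => q; rewrite !ffunE.
Qed.

Lemma delta_ext_root_dfa_init (Sigma Q : finType) (A : dfa Sigma Q)
    (w : seq Sigma) :
  delta_ext (root_dfa A) (dfa_init (root_dfa A)) w = delta_word A w.
Proof. by rewrite delta_ext_root_dfa; apply/ffunP => q; rewrite !ffunE. Qed.

Lemma delta_ext_word_exp (Sigma Q : finType) (A : dfa Sigma Q)
    (w : seq Sigma) (n : nat) (q : Q) :
  delta_ext A q (word_exp w n) = tr_exp (delta_word A w) n q.
Proof.
elim: n q => [|n IHn] q; first by rewrite ffunE.
(* Both powers unfold with the new factor acting first, so the induction hypothesis applies at the
   state reached from [q] by [w]. *)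
by rewrite /delta_ext foldl_cat [LHS]IHn !ffunE.
Qed.

Theorem theorem1p1 (Sigma Q : finType) (A : dfa Sigma Q) :
  lang_root (dfa_lang A) = dfa_lang (root_dfa A).
Proof.
apply/seteqP; split=> w; rewrite /dfa_lang /= delta_ext_root_dfa_init inE.
  by case=> n [n_gt0 Lwn]; apply/asboolP; exists n; rewrite -delta_ext_word_exp.
by move=> /asboolP[n [n_gt0 Fwn]]; exists n; rewrite /= delta_ext_word_exp.
Qed.
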